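(* Let $m\ge 0$ be an integer and let $n_0,n_1,\dots,n_{m+1}$ be positive integers such that $n_0$ is odd, there is no positive odd integer $n$ with $n_0=(3n+1)/2$, $n_i=(3n_{i-1}+1)/2$ for $i=1,2,\dots,m+1$, the numbers $n_1,\dots,n_m$ are odd, and $n_{m+1}$ is even. Then there is a positive odd integer $t$ not divisible by $3$ such that $$n_i=2^{m+1-i}\,3^{i}\,t-1\qquad\text{for } i=0,1,2,\dots,m+1.$$
   Context: Such a finite sequence $n_0,\dots,n_{m+1}$ is what the paper calls a Collatz's Sequence, denoted $S_c(m,t)$, with terms $n_i=n_i(m,t)$. *)

(* Defs.v *)
From mathcomp Require Import all_boot.

Set Implicit Arguments.
Unset Strict Implicit.
Unset Printing Implicit Defensive.

(* The sequence n_0, ..., n_{m+1} is given by a function on nat constrained   *)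
(* only on indices i <= m.+1.  The quotient by 2 in the recursion is exact,   *)
(* since it is only applied to 3 * k + 1 with k odd.                          *)
Definition collatz_sequence (m : nat) (n : nat -> nat) : Prop :=
  [/\ forall i : nat, i <= m.+1 -> 0 < n i,
      odd (n 0) /\
        ~ (exists k : nat, [/\ 0 < k, odd k & n 0 = (3 * k + 1) %/ 2]),
      forall i : nat, 1 <= i <= m.+1 -> n i = (3 * n i.-1 + 1) %/ 2,
      forall i : nat, 1 <= i <= m -> odd (n i)
    & ~~ odd (n m.+1)].

(* Main.v *)
Require Import Defs.
From mathcomp Require Import all_boot.
From mathcomp Require Import zify.

(** On odd numbers the map k |-> (3k+1)/2 becomes multiplication by 3/2 after
    the shift k |-> k+1, so 2^i (n_i + 1) = 3^i (n_0 + 1).  Taking i = m+1 shows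
    that 2^(m+1) divides n_0 + 1, and t is the quotient.  It is odd since
    n_(m+1) + 1 = 3^(m+1) t is odd, and 3 does not divide it since
    n_0 = 3u - 1 is the image of the odd number 2u - 1. *)

Lemma odd_collatz_step (k : nat) :
  odd k -> 2 * ((3 * k + 1) %/ 2).+1 = 3 * k.+1.
Proof. by lia. Qed.

Lemma collatz_sequence_shifted (m : nat) (n : nat -> nat) (i : nat) :
  collatz_sequence m n -> i <= m.+1 -> 2 ^ i * (n i).+1 = 3 ^ i * (n 0).+1.
Proof.
case=> _ [odd_n0 _] step odd_n _; elim: i => [//|i IHi] lt_i_m1.
(* Oddness is available exactly for the indices up to [m], index 0 being a separate hypothesis. *)
have odd_ni : odd (n i) by case: i {IHi} lt_i_m1 => [//|i] lt_i_m1; apply: odd_n.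
rewrite (step i.+1) //= expnSr -mulnA odd_collatz_step //.
by rewrite mulnCA IHi 1?ltnW // mulnA expnS.
Qed.

Theorem lemma3p1 (m : nat) (n : nat -> nat) (hn : collatz_sequence m n) :
  exists t : nat,
    [/\ 0 < t, odd t, ~~ (3 %| t)
      & forall i : nat, i <= m.+1 -> n i = 2 ^ (m.+1 - i) * 3 ^ i * t - 1].
Proof.
have shifted i := @collatz_sequence_shifted m n i hn.
have /dvdnP[t n0E] : 2 ^ m.+1 %| (n 0).+1.
  (* Since 2 and 3 are coprime, the factor 3^(m+1) can be inserted, and the shifted identity at m+1
     applies. *)
  rewrite -(@Gauss_dvdr _ (3 ^ m.+1)) ?coprimeXl ?coprimeXr //.
  by rewrite -shifted // dvdn_mulr.
have niE i : i <= m.+1 -> (n i).+1 = 2 ^ (m.+1 - i) * 3 ^ i * t.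
  move=> le_i_m1; apply/eqP; rewrite -(eqn_pmul2l (expn_gt0 2 i)) shifted //.
  by rewrite n0E -{1}(subnKC le_i_m1) expnD; apply/eqP; lia.
case: hn => _ [odd_n0 not_image] _ _ even_nm1.
exists t; split; last by move=> i /niE <-; rewrite subn1.
- by case: t n0E {niE}.
- move: (niE m.+1 (leqnn _)) => /(congr1 odd).
  by rewrite subnn mul1n oddM /= even_nm1 => /esym/andP[].
- apply/negP=> /dvdnP[u tE]; apply: not_image.
  (* Here [u] is t/3 and [v] is (n_0 + 1)/3, so that 2v - 1 is the forbidden odd preimage of n_0. *)
  have [v n0v] : exists v, (n 0).+1 = 3 * v.
    by exists (u * 2 ^ m.+1); rewrite n0E tE; lia.
  by exists (2 * v).-1; split; lia.
Qed.
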